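(* Let $R$ be a finite ring with identity, $M$ a finite Frobenius $(R,R)$-bimodule and $n\in\mathbb{N}$. Let $\omega$ be the homogeneous weight on $M$, extended additively to $M^n$. Let $\mathcal{C}\subseteq M^n$ be a left $R$-submodule and $f:\mathcal{C}\longrightarrow M^n$ a left $R$-linear $\omega$-preserving map. Then there exists some matrix $A\in\mathrm{Mon}_n(R)$ such that $f(v)=vA$ for all $v\in\mathcal{C}$. In particular, $f$ extends to an $\omega$-preserving linear map on $M^n$. As a consequence, a left $R$-linear map $f:\mathcal{C}\longrightarrow M^n$ preserves the homogeneous weight if and only if it preserves the Hamming weight.
   Context: For a finite ring $R$ with identity, the character group $\widehat{R}=\mathrm{Hom}((R,+),\mathbb{C}^* )$ is an $(R,R)$-bimodule via $(r\cdot\chi)(a)=\chi(ar)$ and $(\chi\cdot r)(a)=\chi(ra)$. A finite $(R,R)$-bimodule $M$ is called a Frobenius bimodule if ${}_RM\cong{}_R\widehat{R}$ as left $R$-modules and $M_R\cong\widehat{R}_R$ as right $R$-modules. Elements of $M^n$ are row vectors; for a matrix $A\in R^{n\times n}$ and $v\in M^n$, the product $vA\in M^n$ is defined in the usual way using the right $R$-module structure of $M$. $\mathrm{Mon}_n(R)$ is the group of matrices in $\mathrm{GL}_n(R)$ with exactly one nonzero entry in each row and each column (these entries are then units). A (normalized left) homogeneous weight on a finite left $R$-module $M$ is a map $\omega:M\to\mathbb{C}$ with $\omega(0)=0$ such that (i) $\omega(v)=\omega(w)$ for all $v,w\in M$ with $Rv=Rw$, and (ii) $\sum_{w\in Rv}\omega(w)=|Rv|$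 for all $v\in M\setminus\{0\}$. It is known that such a weight exists and is unique on every finite module. It is extended to $M^n$ by $\omega(v_1,\ldots,v_n)=\sum_{i=1}^n\omega(v_i)$. The Hamming weight on $M^n$ is $\mathrm{wt}_{\mathrm H}(v_1,\ldots,v_n)=|\{i\mid v_i\neq0\}|$. A linear map $f:\mathcal{C}\to M^n$ preserves a weight $\mathrm{wt}$ on $M^n$ if $\mathrm{wt}(f(v))=\mathrm{wt}(v)$ for all $v\in\mathcal{C}$. *)

(* Defs.v *)
From HB Require Import structures.
From mathcomp Require Import all_boot all_algebra reals complex.

Set Implicit Arguments.
Unset Strict Implicit.
Unset Printing Implicit Defensive.

Import GRing.Theory.
Local Open Scope ring_scope.

HB.mixin Record Lmodule_isBimodule (R : pzRingType) M of GRing.Lmodule R M := {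
  rscale : M -> R -> M;
  rscalerA : forall v a b, rscale (rscale v a) b = rscale v (a * b);
  rscaler1 : right_id 1 rscale;
  rscalerDl : left_distributive rscale +%R;
  rscalerDr : forall v, {morph rscale v : a b / a + b};
  scaler_rscale : forall a v b, rscale (a *: v) b = a *: rscale v b
}.

#[short(type="bimodType")]
HB.structure Definition Bimodule (R : pzRingType) :=
  {M of GRing.Lmodule R M & Lmodule_isBimodule R M}.

#[short(type="finBimodType")]
HB.structure Definition FinBimodule (R : nzRingType) :=
  {M of Bimodule R M & Finite M}.

Notation "v *:> a" := (rscale v a) (at level 40, left associativity) : ring_scope.

Section Character.
Variables (K : realType) (R : finNzRingType).

Definition is_char (chi : {ffun R -> K[i]}) : bool :=
  [forall a, chi a != 0] && [forall a, forall b, chi (a + b) == chi a * chi b].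

Record character := Character {
  char_val :> {ffun R -> K[i]};
  char_valP : is_char char_val
}.

HB.instance Definition _ := [isSub of character for char_val].
HB.instance Definition _ := [Choice of character by <:].

Implicit Types (chi psi : character) (a b r : R).

Lemma charP (chi psi : character) : (forall a, chi a = psi a) -> chi = psi.
Proof. by move=> e; apply/val_inj/ffunP. Qed.

Lemma char_neq0 chi a : chi a != 0.
Proof. by have /andP[/forallP] := char_valP chi. Qed.

Lemma charD chi a b : chi (a + b) = chi a * chi b.
Proof. by have /andP[_ /forallP/(_ a)/forallP/(_ b)/eqP] := char_valP chi. Qed.

Lemma is_charP (g : R -> K[i]) :
    (forall a, g a != 0) -> (forall a b, g (a + b) = g a * g b) ->
  is_char (finfun g).
Proof.
move=> g0 gD; apply/andP; split; apply/forallP => a; first by rewrite ffunE.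
by apply/forallP => b; rewrite !ffunE gD.
Qed.

Fact char_one_subproof : is_char [ffun=> 1].
Proof. by apply: is_charP => *; rewrite ?oner_neq0 ?mulr1. Qed.
Definition char_one := Character char_one_subproof.

Fact char_inv_subproof chi : is_char [ffun a => (chi a)^-1].
Proof.
by apply: is_charP => *; rewrite ?invr_eq0 ?char_neq0// charD invfM.
Qed.
Definition char_inv chi := Character (char_inv_subproof chi).

Fact char_mul_subproof chi psi : is_char [ffun a => chi a * psi a].
Proof.
by apply: is_charP => *; rewrite ?mulf_neq0 ?char_neq0// !charD mulrACA.
Qed.
Definition char_mul chi psi := Character (char_mul_subproof chi psi).

Fact char_mulA : associative char_mul.
Proof. by move=> chi psi xi; apply: charP => a; rewrite !ffunE mulrA. Qed.
Fact char_mulC : commutative char_mul.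
Proof. by move=> chi psi; apply: charP => a; rewrite !ffunE mulrC. Qed.
Fact char_mul1 : left_id char_one char_mul.
Proof. by move=> chi; apply: charP => a; rewrite !ffunE mul1r. Qed.
Fact char_mulV : left_inverse char_one char_inv char_mul.
Proof. by move=> chi; apply: charP => a; rewrite !ffunE mulVf ?char_neq0. Qed.

(* The character group is written additively: chi + psi is the pointwise
   product, 0 the trivial character and - chi the pointwise inverse. *)
HB.instance Definition _ := GRing.isZmodule.Build character
  char_mulA char_mulC char_mul1 char_mulV.

Fact char_lscale_subproof r chi : is_char [ffun a => chi (a * r)].
Proof. by apply: is_charP => *; rewrite ?char_neq0// mulrDl charD. Qed.
Definition char_lscale r chi := Character (char_lscale_subproof r chi).

Fact char_rscale_subproof chi r : is_char [ffun a => chi (r * a)].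
Proof. by apply: is_charP => *; rewrite ?char_neq0// mulrDr charD. Qed.
Definition char_rscale chi r := Character (char_rscale_subproof chi r).

Fact char_lscaleA r s chi :
  char_lscale r (char_lscale s chi) = char_lscale (r * s) chi.
Proof. by apply: charP => a; rewrite !ffunE mulrA. Qed.
Fact char_lscale1 : left_id 1 char_lscale.
Proof. by move=> chi; apply: charP => a; rewrite !ffunE mulr1. Qed.
Fact char_lscaleDr : right_distributive char_lscale +%R.
Proof. by move=> r chi psi; apply: charP => a; rewrite !ffunE. Qed.
Fact char_lscaleDl chi : {morph char_lscale^~ chi : r s / r + s}.
Proof. by move=> r s; apply: charP => a; rewrite !ffunE mulrDr charD. Qed.

HB.instance Definition _ := GRing.Zmodule_isLmodule.Build R character
  char_lscaleA char_lscale1 char_lscaleDr char_lscaleDl.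

Fact char_rscaleA chi r s :
  char_rscale (char_rscale chi r) s = char_rscale chi (r * s).
Proof. by apply: charP => a; rewrite !ffunE mulrA. Qed.
Fact char_rscale1 : right_id 1 char_rscale.
Proof. by move=> chi; apply: charP => a; rewrite !ffunE mul1r. Qed.
Fact char_rscaleDl : left_distributive char_rscale +%R.
Proof. by move=> chi psi r; apply: charP => a; rewrite !ffunE. Qed.
Fact char_rscaleDr chi : {morph char_rscale chi : r s / r + s}.
Proof. by move=> r s; apply: charP => a; rewrite !ffunE mulrDl charD. Qed.
Fact char_scale_rscale r chi s :
  char_rscale (r *: chi) s = r *: char_rscale chi s.
Proof. by apply: charP => a; rewrite !ffunE mulrA. Qed.

HB.instance Definition _ := Lmodule_isBimodule.Build R character
  char_rscaleA char_rscale1 char_rscaleDl char_rscaleDr char_scale_rscale.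

End Character.

(* The two isomorphisms are not required to coincide. *)
Definition Frobenius_bimodule (K : realType) (R : finNzRingType)
    (M : finBimodType R) : Prop :=
  (exists phi : {linear M -> character K R}, bijective phi) /\
  (exists psi : {additive M -> character K R},
     bijective psi /\ forall v a, psi (v *:> a) = psi v *:> a).

Section Submodule.
Variables (R : nzRingType) (V : lmodType R) (C : submodClosed V).

Record submod := Submod { submod_val :> V; submod_valP : submod_val \in C }.

HB.instance Definition _ := [isSub of submod for submod_val].
HB.instance Definition _ := [Choice of submod by <:].
HB.instance Definition _ := [SubChoice_isSubLmodule of submod by <:].

End Submodule.

Section Codes.
Variables (K : realType) (R : finNzRingType) (M : finBimodType R).

Definition cyclic_submod (v : M) : {set M} := [set r *: v | r in [set: R]].

Definition homogeneous_weight (omega : M -> K[i]) : Prop :=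
  [/\ omega 0 = 0,
      forall v w, cyclic_submod v = cyclic_submod w -> omega v = omega w &
      forall v, v != 0 ->
        \sum_(w in cyclic_submod v) omega w = #|cyclic_submod v|%:R].

Variable n : nat.

(* M^n is {ffun 'I_n -> M}, not 'rV[M]_n: the library scales matrices only by
   their own ring of coefficients. *)
Definition weight_sum (omega : M -> K[i]) (v : {ffun 'I_n -> M}) : K[i] :=
  \sum_i omega (v i).

Definition wtH (v : {ffun 'I_n -> M}) : nat := #|[set i | v i != 0]|.

Definition vmulmx (v : {ffun 'I_n -> M}) (A : 'M[R]_n) : {ffun 'I_n -> M} :=
  [ffun j => \sum_i v i *:> A i j].

(* Invertibility is spelled out because unitmx needs a commutative ring. *)
Definition monomial_mx (A : 'M[R]_n) : Prop :=
  [/\ exists B : 'M[R]_n, A *m B = 1%:M /\ B *m A = 1%:M,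
      forall i, #|[set j | A i j != 0]| = 1%N &
      forall j, #|[set i | A i j != 0]| = 1%N].

Definition preserves (T : Type) (wt : {ffun 'I_n -> M} -> T)
    (C : submodClosed {ffun 'I_n -> M}) (f : submod C -> {ffun 'I_n -> M}) :=
  forall v : submod C, wt (f v) = wt (\val v).

End Codes.

(* Main.v *)
(* From the left isomorphism, [M] has a character [chi] such that the maps
   [v |-> chi (r v)], for [r] in [R], are all the characters of [M]; since [M]
   is faithful on the right, [chi (v r) = chi (sigma r v)] for a multiplicative
   bijection [sigma] of [R].  Let [S v] be the sum of [chi (v u)] over the units
   [u].  The indicator of the units is a linear combination of indicators of
   principal right ideals, and also of principal left ideals, and a character
   sums to zero over an ideal on which it is nontrivial.  Hence [S v] is a
   combination of the truth values of [v r = 0], so it depends only on [Rv], and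
   also one of the truth values of [r v = 0].  The first form shows that
   [1 - S / #|units|] is a homogeneous weight, hence the only one; the second
   shows that a linear map preserving the Hamming weight preserves [omega].

   Conversely, if [f] preserves [omega], orthogonality of the characters
   [x |-> chi (p x u)] on [C] shows that the coordinates of [C] and those of [f]
   fall into the same orbits, with multiplicities, under right multiplication by
   units; a matching of the two families is the monomial matrix. *)
Require Import Defs.
From HB Require Import structures.
From mathcomp Require Import all_boot all_fingroup all_algebra.
From mathcomp Require Import separable cyclotomic reals complex.

Set Implicit Arguments.
Unset Strict Implicit.
Unset Printing Implicit Defensive.

Import GRing.Theory Num.Theory.
Local Open Scope ring_scope.

(** * Orthogonality of additive characters of a finite abelian group *)

Section Orthogonality.
Variables (F : numFieldType) (G : finZmodType).
Implicit Types (theta : G -> F) (A : {set G}).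

Definition add_char theta :=
  theta 0 = 1 /\ {morph theta : x y / x + y >-> x * y}.

Lemma add_char_neq0 theta x : add_char theta -> theta x != 0.
Proof.
case=> th0 thD; apply/eqP => thx0.
by have := oner_neq0 F; rewrite -th0 -(subrr x) thD thx0 mul0r eqxx.
Qed.

(** Translation by [a] permutes [A] and multiplies the sum by [theta a]. *)
Lemma sum_add_char_set theta A a :
    {in A &, forall x y, x + y \in A} -> add_char theta ->
  a \in A -> theta a != 1 -> \sum_(x in A) theta x = 0.
Proof.
move=> AD [_ thD] Aa tha.
have imA : [set x + a | x in A] = A.
  apply/eqP; rewrite eqEcard card_imset ?leqnn ?andbT; last exact: addIr.
  by apply/subsetP => _ /imsetP[x Ax ->]; apply: AD.
have: \sum_(x in A) theta x * (theta a - 1) = 0.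
  rewrite -mulr_suml mulrBr mulr1 mulr_suml -{2}imA big_imset /=; last first.
    by move=> x y _ _ /addIr.
  by apply/eqP; rewrite subr_eq0; apply/eqP/eq_bigr => x _; rewrite thD.
rewrite -mulr_suml => /eqP.
by rewrite mulf_eq0 subr_eq0 (negPf tha) orbF => /eqP.
Qed.

Lemma sum_add_char_set1 theta A :
    (forall x, x \in A -> theta x = 1) ->
  \sum_(x in A) theta x = #|A|%:R.
Proof. by move=> th1; rewrite (eq_bigr _ th1) sumr_const. Qed.

Lemma sum_add_char_divr theta1 theta2 :
    add_char theta1 -> add_char theta2 ->
  \sum_x theta1 x * (theta2 x)^-1 =
    if [forall x, theta1 x == theta2 x] then #|G|%:R else 0.
Proof.
move=> c1 c2; have c x := add_char_neq0 x c2.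
case: ifP => [/forallP eqth | /negbT/forallPn/= [x neq]].
  rewrite (eq_bigr (fun=> 1)) ?sumr_const // => x _.
  by rewrite (eqP (eqth x)) divff.
transitivity (\sum_(x in [set: G]) theta1 x / theta2 x).
  by apply: eq_bigl => y; rewrite inE.
apply: (@sum_add_char_set _ _ x); rewrite ?inE //.
- by move=> y z _ _; rewrite inE.
- split=> [|y z]; first by rewrite c1.1 c2.1 divr1.
  by rewrite c1.2 c2.2 invfM mulrACA.
by apply: contraNneq neq => e; rewrite -(mulfVK (c x) (theta1 x)) e mul1r.
Qed.

(** Orthogonality gives the [#|I|] by [#|G|] table of values a right inverse, so it has no more rows
    than columns. *)
Lemma leq_card_add_char (I : finType) (theta : I -> G -> F) :
    (forall i, add_char (theta i)) ->
    (forall i j, theta i =1 theta j -> i = j) ->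
  (#|I| <= #|G|)%N.
Proof.
move=> thC thI; have G0 : #|G|%:R != 0 :> F.
  by rewrite pnatr_eq0 -lt0n; apply/card_gt0P; exists 0.
pose A := \matrix_(i < #|I|, x < #|G|) theta (enum_val i) (enum_val x).
pose B := \matrix_(x < #|G|, i < #|I|)
  ((theta (enum_val i) (enum_val x))^-1 / #|G|%:R).
apply: (@mulmx1_min F _ _ A B); apply/matrixP => i j; rewrite !mxE.
rewrite (eq_bigr (fun x : 'I_#|G| => theta (enum_val i) (enum_val x) *
   (theta (enum_val j) (enum_val x))^-1 / #|G|%:R)); last first.
  by move=> x _; rewrite !mxE mulrA.
rewrite -mulr_suml.
rewrite -(reindex enum_val (P := xpredT)
  (F := fun x : G => theta (enum_val i) x / theta (enum_val j) x)) /=;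
  last by apply: onW_bij; exact: enum_val_bij.
rewrite sum_add_char_divr //.
case: eqVneq => [-> | neq].
  by rewrite ifT ?divff //; apply/forallP.
rewrite ifF ?mul0r //; apply: contraNF neq => /forallP e.
by apply/eqP/enum_val_inj/thI => x; apply/eqP.
Qed.

(* Orthogonality reads off the multiplicity of a character in a finite
   family from the sum of the family. *)
Lemma count_add_char (I : finType) (P : pred I) (th1 th2 : I -> G -> F)
    (th : G -> F) :
    (forall i, add_char (th1 i)) -> (forall i, add_char (th2 i)) ->
    add_char th ->
    (forall x, \sum_(i | P i) th1 i x = \sum_(i | P i) th2 i x) ->
  #|[set i | P i && [forall x, th1 i x == th x]]| =
  #|[set i | P i && [forall x, th2 i x == th x]]|.
Proof.
move=> c1 c2 c e; have G0 : #|G|%:R != 0 :> F.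
  by rewrite pnatr_eq0 -lt0n; apply/card_gt0P; exists 0.
have count th' : (forall i, add_char (th' i)) ->
    \sum_x (\sum_(i | P i) th' i x) / th x =
    #|[set i : I | P i && [forall x, th' i x == th x]]|%:R * #|G|%:R.
  move=> c'; under eq_bigr do rewrite mulr_suml.
  rewrite exchange_big /=.
  under eq_bigr => i _ do rewrite sum_add_char_divr //.
  by rewrite -big_mkcondr /= sumr_const -mulrnA natrM mulrC cardsE.
apply/eqP; rewrite -(eqr_nat F); apply/eqP/(mulIf G0).
by rewrite -!count //; apply: eq_bigr => x _; rewrite e.
Qed.

End Orthogonality.

(** Möbius inversion for a preorder: the coefficients are determined from the largest down-sets
    downwards. *)
Lemma downset_span (F : numFieldType) (T : finType) (le : rel T) (h : T -> F) :
    reflexive le -> transitive le ->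
    (forall s t, le s t -> le t s -> h s = h t) ->
  exists d : T -> F, forall t, h t = \sum_(r | le t r) d r.
Proof.
move=> le_refl le_trans; pose rk t := #|[set s | le s t]|.
have rk_le s t : le s t -> (rk s <= rk t)%N.
  by move=> st; apply/subset_leq_card/subsetP => x; rewrite !inE => /le_trans->.
have rk_anti s t : le s t -> (rk t <= rk s)%N -> le t s.
  move=> st ts; have : [set x | le x s] == [set x | le x t].
    rewrite eqEcard ts andbT; apply/subsetP => x; rewrite !inE.
    by move=> /le_trans->.
  by move=> /eqP/setP/(_ t); rewrite !inE le_refl.
suff main m (h' : T -> F) : (forall s t, le s t -> le t s -> h' s = h' t) ->
    (forall t, (m <= rk t)%N -> h' t = 0) ->
    exists d : T -> F, forall t, h' t = \sum_(r | le t r) d r.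
  move=> hcl; apply: (main #|T|.+1) => // t.
  by rewrite ltnNge max_card.
elim: m h' => [|m IHm] {}h hcl h0.
  by exists (fun=> 0) => t; rewrite h0 // big1.
pose cl r := [set s | le s r && le r s].
(* Elements of rank [m] above a [t] of rank [m] are exactly the class of [t]; dividing by its size
   makes them contribute [h t] in total. *)
pose d0 r := if rk r == m then h r / #|cl r|%:R else 0.
have [|t mt|d hd] := IHm (fun t => h t - \sum_(r | le t r) d0 r).
- move=> s t st ts; rewrite (hcl s t) //; congr (_ - _); apply: eq_bigl => r.
  by apply/idP/idP; apply: le_trans.
- move: mt; rewrite leq_eqVlt => /orP[/eqP mt | mt]; last first.
    rewrite h0 // big1 ?subr0 // => r tr; rewrite /d0 ifN //.
    by rewrite neq_ltn (leq_trans mt) ?orbT // rk_le.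
  apply/eqP; rewrite subr_eq0 eq_sym.
  rewrite (bigID (fun r => le r t)) /= [X in _ + X]big1 => [|r /andP[tr rt]].
    rewrite addr0 (eq_bigr (fun=> h t / #|cl t|%:R)) => [|r /andP[tr rt]].
      rewrite sumr_const -[X in _ *+ X]cardsE.
      have -> : [set r | le t r && le r t] = cl t.
        by apply/setP => r; rewrite !inE andbC.
      rewrite -(mulr_natr (h t / _)) mulfVK // pnatr_eq0 -lt0n; apply/card_gt0P.
      by exists t; rewrite !inE le_refl.
    have -> : cl t = cl r.
      apply/setP => s; rewrite !inE; apply/andP/andP => -[].
        by move=> /le_trans-> // /(le_trans _ _ _ rt)->.
      by move=> /le_trans-> // /(le_trans _ _ _ tr)->.
    have -> : h t = h r by apply: hcl.
    by rewrite /d0 ifT // mt eqn_leq !rk_le.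
  rewrite /d0 ifN //; apply: contra rt => /eqP rm; apply: rk_anti => //.
  by rewrite rm mt.
exists (fun r => d r + d0 r) => t.
by rewrite big_split /= -hd subrK.
Qed.

(** * Characters separate points *)

(** The minimal polynomial divides ['X^(m.+1) - 1], which is separable in characteristic zero. *)
Lemma diagonalizable_root1 (F : numClosedFieldType) n m (A : 'M[F]_n) :
  iter m.+1 (mulmx A) 1%:M = 1%:M -> diagonalizable A.
Proof.
case: n A => [|n] A Am.
  by exists 1%:M; rewrite ?unitmx1 //; apply/is_diag_mxP => -[].
have [rs] := closed_field_poly_normal ('X^(m.+1) - 1 : {poly F}).
rewrite lead_coefXnsubC // scale1r => Drs.
apply/diagonalizableP; exists rs.
  by rewrite -separable_prod_XsubC -Drs separable_Xn_sub_1 // pnatr_eq0.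
rewrite -Drs mxminpoly_min // rmorphB rmorphXn rmorph1 /= horner_mx_X.
have -> k : A ^+ k = iter k (mulmx A) 1%:M; last by rewrite Am subrr.
by elim: k => [|k IHk]; rewrite ?expr0 // exprS IHk.
Qed.

(* The translations of G, acting on functions on G, are commuting
   diagonalizable operators; a common eigenvector is, up to scaling, a
   character, and translation by x <> 0 cannot have only eigenvalue 1. *)
Lemma add_char_separates (F : numClosedFieldType) (G : finZmodType) (x : G) :
  x != 0 -> exists2 theta : G -> F, add_char theta & theta x != 1.
Proof.
move=> x0; pose T a : 'M[F]_#|G| :=
  \matrix_(i, j) (enum_val j == enum_val i + a)%:R.
have TD a b : T a *m T b = T (a + b).
  apply/matrixP => i j; rewrite !mxE.
  pose k := enum_rank (enum_val i + a).
  rewrite (bigD1 k) //= big1 => [|l lk].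
    by rewrite !mxE enum_rankK eqxx mul1r addr0 addrA.
  rewrite mxE; case: eqP => [e|]; last by rewrite mul0r.
  by rewrite /k -e enum_valK eqxx in lk.
have T0 : T 0 = 1%:M.
  by apply/matrixP => i j; rewrite !mxE addr0 (inj_eq enum_val_inj) eq_sym.
have Tn a m : iter m (mulmx (T a)) 1%:M = T (a *+ m).
  by elim: m => [|m IHm] //=; rewrite IHm TD mulrS.
pose As := [seq T a | a <- enum G].
have [|P Pu /allP/= diagP] := (codiagonalizableP As).1.
  split=> [_ _ /mapP[a _ ->] /mapP[b _ ->]|_ /mapP[a _ ->]].
    by rewrite /comm_mx !TD addrC.
  have: a *+ #[a]%g = 0 by rewrite -FinRing.zmodXgE expg_order.
  have: (0 < #[a]%g)%N by exact: order_gt0.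
  case: #[a]%g => // m _ am; apply: (@diagonalizable_root1 _ _ m).
  by rewrite Tn am T0.
pose D a := P *m T a *m invmx P.
have DD a b : D a *m D b = D (a + b).
  by rewrite /D !mulmxA mulmxKV // -TD !mulmxA.
have Ddiag a i j : i != j -> D a i j = 0.
  have /diagP : T a \in As by apply/map_f; rewrite mem_enum.
  by move=> + ij; rewrite /= /similar_to conjumx // => /is_diag_mxP; apply.
have D0 : D 0 = 1%:M by rewrite /D T0 mulmx1 mulmxV.
(* If every eigenvalue of [T x] were 1, [T x] would be the identity, and its diagonal entry at the
   zero of [G] would give [x = 0]. *)
have [/forallP D1|/forallPn/= [i Dxi]] := boolP [forall i, D x i i == 1].
  case/negP: x0; have : D x = 1%:M.
    apply/matrixP => i j; rewrite [RHS]mxE.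
    by case: eqVneq => [->|/Ddiag->]; [apply/eqP|].
  move=> /(congr1 (fun A => invmx P *m A *m P)).
  rewrite /D mulmx1 mulVmx // !mulmxA mulVmx // mul1mx mulmxKV //.
  move=> /matrixP/(_ (enum_rank 0) (enum_rank 0)).
  rewrite !mxE eqxx !enum_rankK add0r eq_sym => /eqP.
  by case: (x == 0) => //; rewrite eq_sym oner_eq0.
exists (fun a => D a i i) => //; split=> [|a b]; first by rewrite D0 mxE eqxx.
rewrite -DD mxE (bigD1 i) //= big1 ?addr0 // => j ij.
by rewrite Ddiag 1?eq_sym // mul0r.
Qed.

(** * Bimodule arithmetic and units of a finite ring *)

Section Bimodule.
Variables (R : pzRingType) (M : bimodType R).
Implicit Types (v w : M) (a b : R).

Lemma rscale0r a : (0 : M) *:> a = 0.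
Proof. by apply: (addrI (0 *:> a)); rewrite -rscalerDl !addr0. Qed.

Lemma rscaler0 v : v *:> (0 : R) = 0.
Proof. by apply: (addrI (v *:> 0)); rewrite -rscalerDr !addr0. Qed.

Lemma rscalerBr v a b : v *:> (a - b) = v *:> a - v *:> b.
Proof. by apply/(canRL (addrK _)); rewrite -rscalerDr subrK. Qed.

End Bimodule.

Lemma add_char_subr (F : numFieldType) (G : finZmodType) (theta : G -> F) x y :
  add_char theta -> theta x = theta y -> theta (x - y) = 1.
Proof.
move=> c e; apply/(mulIf (add_char_neq0 y c)).
by rewrite -c.2 subrK e mul1r.
Qed.

Section FiniteUnits.
Variable R : finNzRingType.

(** Right multiplication by [x] is injective, hence surjective by finiteness, so [x] has a left
    inverse, which must be [y]. *)
Lemma fin_mulr1C (x y : R) : x * y = 1 -> y * x = 1.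
Proof.
move=> xy1; have inj : injective ( *%R^~ x).
  by move=> r s /(congr1 ( *%R^~ y)); rewrite /= -!mulrA xy1 !mulr1.
have [g _ gK] := injF_bij inj.
move: (g 1) (gK 1) => z /= zx1.
by rewrite -[y]mul1r -zx1 -(mulrA z) xy1 mulr1.
Qed.

Definition fin_units : {set R} := [set u | [exists v, v * u == 1]].

Lemma fin_unitsP u :
  reflect (exists v, v * u = 1 /\ u * v = 1) (u \in fin_units).
Proof.
rewrite inE; apply: (iffP existsP) => [[v /eqP vu1]|[v [vu1 _]]].
  by exists v; split=> //; apply: fin_mulr1C.
by exists v; apply/eqP.
Qed.

Lemma fin_units1 : 1 \in fin_units.
Proof. by apply/fin_unitsP; exists 1; rewrite mulr1. Qed.

Lemma fin_unitsM u v :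
  u \in fin_units -> v \in fin_units -> u * v \in fin_units.
Proof.
move=> /fin_unitsP[u' [u'u _]] /fin_unitsP[v' [v'v _]].
rewrite inE; apply/existsP; exists (v' * u').
by rewrite mulrA -(mulrA v') u'u mulr1 v'v.
Qed.

Lemma card_fin_units_neq0 (F : numFieldType) : #|fin_units|%:R != 0 :> F.
Proof.
by rewrite pnatr_eq0 -lt0n; apply/card_gt0P; exists 1; apply: fin_units1.
Qed.

End FiniteUnits.

(* The right action of R on M is transported to the left one by an
   automorphism sigma of the multiplicative monoid of R, since the two
   isomorphisms of a Frobenius bimodule need not coincide. *)
Definition generating_char (F : numFieldType) (R : finNzRingType)
    (M : finBimodType R) (chi : M -> F) (sigma : R -> R) : Prop :=
  [/\ add_char chi, forall v, (forall r, chi (r *: v) = 1) -> v = 0,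
      bijective sigma, {morph sigma : r s / r * s} &
      forall v r, chi (v *:> r) = chi (sigma r *: v)].

(** * Existence of a generating character *)

Lemma character_add_char (K : realType) (R : finNzRingType)
  (c : character K R) : add_char c.
Proof.
split=> [|x y]; last exact: charD.
by apply: (mulfI (char_neq0 c 0)); rewrite -charD mulr1 addr0.
Qed.

Lemma character_separates (K : realType) (R : finNzRingType) (x : R) :
  x != 0 -> exists c : character K R, c x != 1.
Proof.
move=> /(@add_char_separates K[i])[th thC thx].
have th_char : is_char (finfun th).
  by apply: is_charP; [move=> a; apply: add_char_neq0 | case: thC].
by exists (Character th_char); rewrite /= ffunE.
Qed.

(** Evaluating the left isomorphism at 1 gives [chi]. Counting characters of [M] gives [sigma], and
    the right isomorphism gives the faithfulness that makes [sigma] injective. *)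
Lemma Frobenius_generating_char (K : realType) (R : finNzRingType)
    (M : finBimodType R) :
  Frobenius_bimodule K M ->
  exists chi : M -> K[i], exists sigma : R -> R, generating_char chi sigma.
Proof.
case=> -[phi [phi' phiK phi'K]] [psi [[psi' psiK psi'K] psiZ]].
have phiD v w a : phi (v + w) a = phi v a * phi w a by rewrite raddfD ffunE.
have phiZ r v a : phi (r *: v) a = phi v (a * r) by rewrite linearZ ffunE.
pose chi v := phi v 1.
have chiC : add_char chi.
  split=> [|v w]; last exact: phiD.
  by rewrite /chi raddf0 ffunE.
have chiN r v : chi (r *: v) = phi v r by rewrite /chi phiZ mul1r.
have chi_left v : (forall r, chi (r *: v) = 1) -> v = 0.
  move=> v1; apply: (can_inj phiK); apply: Defs.charP => a.
  by rewrite raddf0 ffunE -chiN v1.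
(* [chi (s *: v)] is [phi v s], and [phi v] runs over all characters of [R]. *)
have chi_ann s : (forall v, chi (s *: v) = 1) -> s = 0.
  move=> s1; apply/eqP/negPn/negP => /(@character_separates K)[c /eqP[]].
  by rewrite -(s1 (phi' c)) chiN phi'K.
have chi_inj s t : (forall v, chi (s *: v) = chi (t *: v)) -> s = t.
  move=> st; apply/eqP; rewrite -subr_eq0; apply/eqP/chi_ann => v.
  by rewrite scalerBl add_char_subr.
have faith r : (forall v : M, v *:> r = 0) -> r = 0.
  move=> r0; apply/eqP/negPn/negP => /(@character_separates K)[c /eqP[]].
  have /(congr1 (fun c : character K R => c 1)) := psiZ (psi' c) r.
  by rewrite r0 raddf0 psi'K !ffunE mulr1.
have leMR : (#|M| <= #|R|)%N.
  apply: (@leq_card_add_char _ R M (fun v => phi v : R -> K[i])).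
    by move=> v; apply: character_add_char.
  by move=> v w e; apply: (can_inj phiK); apply: Defs.charP.
have chiZ s : add_char (fun v => chi (s *: v)).
  by split=> [|v w]; rewrite ?scaler0 ?scalerDr; case: chiC.
have ex_sigma r : exists s, forall v, chi (v *:> r) = chi (s *: v).
  suff /existsP[s /forallP e] :
      [exists s, [forall v, chi (v *:> r) == chi (s *: v)]].
    by exists s => v; apply/eqP.
  apply: contraT; rewrite negb_exists => /forallP no.
  suff : (#|{: option R}| <= #|M|)%N by rewrite card_option ltnNge leMR.
  (* [None] indexes the extra character: [M] would have [#|R| + 1] distinct characters although
     [#|M| <= #|R|]. *)
  pose th (o : option R) v :=
    if o is Some s then chi (s *: v) else chi (v *:> r).
  apply: (@leq_card_add_char _ _ _ th).
    case=> [s|] /=; first exact: chiZ.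
    by split=> [|v w]; rewrite /= ?rscale0r ?rscalerDl; case: chiC.
  case=> [s|] [t|] //= st; first by congr Some; apply: chi_inj.
    by case/negP: (no s); apply/forallP => v; apply/eqP/esym/(st v).
  by case/negP: (no t); apply/forallP => v; apply/eqP/(st v).
have [sigma sigmaE] := fin_all_exists ex_sigma.
exists chi, sigma; split=> // [|r s].
  apply: injF_bij => r s rs; apply/eqP; rewrite -subr_eq0; apply/eqP/faith => v.
  apply: chi_left => t; rewrite rscalerBr scalerBr add_char_subr //.
  by rewrite -!scaler_rscale !sigmaE rs.
apply: chi_inj => v; rewrite -sigmaE -rscalerA sigmaE -scaler_rscale sigmaE.
by rewrite scalerA.
Qed.

(** * Sums of the generating character over the units *)

Section UnitSums.
Variables (F : numFieldType) (R : finNzRingType).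

(* [le] stands for divisibility on either side, so that its down-sets are the
   principal one-sided ideals and the units form a class. *)
Lemma unit_sum_span (T : Type) (le : rel R) (theta : T -> R -> F)
    (Z : T -> R -> bool) :
    reflexive le -> transitive le ->
    (forall r s t, le s r -> le t r -> le (s + t) r) ->
    (forall s t, le s t -> s \in fin_units R -> t \in fin_units R) ->
    (forall v, add_char (theta v)) ->
    (forall v r, Z v r <-> forall t, le t r -> theta v t = 1) ->
  exists d : R -> F, forall v,
    \sum_(u in fin_units R) theta v u = \sum_r d r * (Z v r)%:R.
Proof.
move=> le_refl le_trans leD leU thC ZE.
have [s t st ts|d hd] := downset_span (h := fun t => (t \in fin_units R)%:R : F)
    le_refl le_trans.
  by congr (_%:R : F); congr nat_of_bool; apply/idP/idP; apply: leU.
(* The sum of [theta v] over the ideal below [r] is the size of the ideal if [Z v r] holds and zero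
   otherwise. *)
exists (fun r => d r * #|[set t | le t r]|%:R) => v.
transitivity (\sum_t \sum_(r | le t r) d r * theta v t).
  rewrite big_mkcond; apply: eq_bigr => t _; rewrite -mulr_suml -hd.
  by case: (t \in _); rewrite ?mul1r ?mul0r.
rewrite (exchange_big_dep xpredT) //=; apply: eq_bigr => r _.
rewrite -mulr_sumr -mulrA; congr (_ * _).
have -> : \sum_(t | le t r) theta v t = \sum_(t in [set t | le t r]) theta v t.
  by apply: eq_bigl => t; rewrite inE.
have [Zv | /negP nZ] := boolP (Z v r).
  rewrite mulr1; apply: sum_add_char_set1 => t; rewrite inE.
  by apply: (ZE v r).1.
rewrite mulr0.
have /forallPn/= [t] : ~~ [forall t, le t r ==> (theta v t == 1)].
  apply/negP => /forallP h; apply/nZ/ZE => t tr.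
  by apply/eqP; move: (h t); rewrite tr.
rewrite negb_imply => /andP[tr tht].
apply: (sum_add_char_set (a := t)); rewrite ?inE //.
by move=> x y; rewrite !inE; apply: leD.
Qed.

Variables (M : finBimodType R) (chi : M -> F) (sigma : R -> R).
Hypothesis gen : generating_char chi sigma.
Let U := fin_units R.

Definition unit_sum v := \sum_(u in U) chi (v *:> u).

Let chiC : add_char chi. Proof. by case: gen. Qed.
Let chi_left v : (forall r, chi (r *: v) = 1) -> v = 0.
Proof. by case: gen => _ + _ _ _; apply. Qed.
Let sigma_bij : bijective sigma. Proof. by case: gen. Qed.
Let sigmaM : {morph sigma : r s / r * s}. Proof. by case: gen. Qed.
Let chi_sigma v r : chi (v *:> r) = chi (sigma r *: v).
Proof. by case: gen. Qed.

Lemma generating_char_right v : (forall r, chi (v *:> r) = 1) -> v = 0.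
Proof.
case: sigma_bij => sigma' _ sigmaK v1; apply: chi_left => r.
by rewrite -(sigmaK r) -chi_sigma v1.
Qed.

Lemma generating_char_lscale v : add_char (fun r => chi (r *: v)).
Proof. by split=> [|r s]; rewrite ?scale0r ?scalerDl; case: chiC. Qed.

Lemma generating_char_rscale v : add_char (fun r => chi (v *:> r)).
Proof. by split=> [|r s]; rewrite ?rscaler0 ?rscalerDr; case: chiC. Qed.

Lemma generating_char_rscalel r : add_char (fun v => chi (v *:> r)).
Proof. by split=> [|v w]; rewrite ?rscale0r ?rscalerDl; case: chiC. Qed.

(** The character [chi (v *:> t)] of [t] is trivial on the right ideal [rR] exactly when
    [v *:> r = 0]. *)
Lemma unit_sum_rann :
  exists d : R -> F, forall v, unit_sum v = \sum_r d r * (v *:> r == 0)%:R.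
Proof.
apply: (@unit_sum_span _ (fun t r => [exists s, t == r * s])).
- by move=> r; apply/existsP; exists 1; rewrite mulr1.
- move=> s r t /existsP[x /eqP->] /existsP[y /eqP->].
  by apply/existsP; exists (y * x); rewrite mulrA.
- move=> r s t /existsP[x /eqP->] /existsP[y /eqP->].
  by apply/existsP; exists (x + y); rewrite mulrDr.
- move=> s t /existsP[x /eqP->] /fin_unitsP[y [_ txy]].
  rewrite inE; apply/existsP; exists (x * y).
  by apply/eqP/fin_mulr1C; rewrite mulrA.
- exact: generating_char_rscale.
move=> v r; split=> [/eqP vr0 _ /existsP[s /eqP->]|h].
  by rewrite -rscalerA vr0 rscale0r; case: chiC.
apply/eqP/generating_char_right => s; rewrite rscalerA h //.
by apply/existsP; exists s.
Qed.

Lemma sigma_fin_units r : (sigma r \in U) = (r \in U).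
Proof.
case: sigma_bij => sigma' sigmaK sigma'K.
(* A multiplicative map fixes 1 as soon as it is surjective. *)
have sigma1 : sigma 1 = 1.
  by rewrite -[LHS]mulr1 -{2}(sigma'K 1) -sigmaM mul1r sigma'K.
apply/fin_unitsP/fin_unitsP => -[v [vu uv]].
  exists (sigma' v).
  by split; apply: (can_inj sigmaK); rewrite sigmaM sigma'K sigma1.
by exists (sigma v); rewrite -!sigmaM vu uv.
Qed.

(** Since [sigma] permutes the units, the unit sum is also the sum of [chi (u *: v)], to which
    principal left ideals apply. *)
Lemma unit_sum_lann :
  exists d : R -> F, forall v, unit_sum v = \sum_r d r * (r *: v == 0)%:R.
Proof.
have [||||||d hd] := @unit_sum_span M (fun t r => [exists s, t == s * r])
    (fun v r => chi (r *: v)) (fun v r => r *: v == 0).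
- by move=> r; apply/existsP; exists 1; rewrite mul1r.
- move=> s r t /existsP[x /eqP->] /existsP[y /eqP->].
  by apply/existsP; exists (x * y); rewrite mulrA.
- move=> r s t /existsP[x /eqP->] /existsP[y /eqP->].
  by apply/existsP; exists (x + y); rewrite mulrDl.
- move=> s t /existsP[x /eqP->] /fin_unitsP[y [yxt _]].
  by rewrite inE; apply/existsP; exists (y * x); rewrite -mulrA yxt.
- exact: generating_char_lscale.
- move=> v r; split=> [/eqP vr0 _ /existsP[s /eqP->]|h].
    by rewrite -scalerA vr0 scaler0; case: chiC.
  apply/eqP/chi_left => s; rewrite scalerA h //.
  by apply/existsP; exists s.
exists d => v; rewrite -hd (reindex sigma) /=; last exact: onW_bij.
by apply: eq_big => u; rewrite ?sigma_fin_units.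
Qed.

Lemma unit_sum_rscale v u : u \in U -> unit_sum (v *:> u) = unit_sum v.
Proof.
move=> Uu; have [u' [u'u uu']] := fin_unitsP u Uu.
rewrite /unit_sum [RHS](reindex ( *%R u)) /=; last first.
  by apply: onW_bij; exists ( *%R u') => x; rewrite mulrA ?u'u ?uu' mul1r.
apply: eq_big => [x|x _]; last by rewrite rscalerA.
apply/idP/idP => [|Uux]; first exact: fin_unitsM.
rewrite -[x]mul1r -u'u -mulrA fin_unitsM //.
by apply/fin_unitsP; exists u.
Qed.

End UnitSums.

(** * The homogeneous weight as a unit sum *)

Section Homogeneous.
Variables (K : realType) (R : finNzRingType) (M : finBimodType R).
Implicit Types (v w : M).

Lemma cyclic_submod_id v : v \in cyclic_submod v.
Proof. by apply/imsetP; exists 1; rewrite ?inE ?scale1r. Qed.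

Lemma cyclic_submod_sub v w :
  w \in cyclic_submod v -> cyclic_submod w \subset cyclic_submod v.
Proof.
case/imsetP=> r _ ->; apply/subsetP => _ /imsetP[s _ ->].
by apply/imsetP; exists (s * r); rewrite ?inE ?scalerA.
Qed.

(** By induction on the size of [Rv] the two weights agree on its non-generators; their difference
    is constant on the generators, so the sum condition makes it zero. *)
Lemma homogeneous_weight_unique (w1 w2 : M -> K[i]) :
  homogeneous_weight w1 -> homogeneous_weight w2 -> w1 =1 w2.
Proof.
case=> w1_0 w1_cyc w1_sum [w2_0 w2_cyc w2_sum] v.
have [m] := ubnP #|cyclic_submod v|; elim: m v => // m IHm v.
rewrite ltnS => vm.
have [->|v0] := eqVneq v 0; first by rewrite w1_0 w2_0.
pose gens := [set w in cyclic_submod v | cyclic_submod w == cyclic_submod v].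
have : \sum_(w in cyclic_submod v) (w1 w - w2 w) = 0.
  by rewrite big_split /= sumrN w1_sum // w2_sum // subrr.
rewrite (bigID (fun w => cyclic_submod w == cyclic_submod v)) /=.
rewrite [X in _ + X]big1 => [|w /andP[wv ne]]; last first.
  apply/eqP; rewrite subr_eq0; apply/eqP/IHm/(leq_trans _ vm)/proper_card.
  by rewrite properEneq ne cyclic_submod_sub.
rewrite addr0 (eq_bigr (fun=> w1 v - w2 v)) => [|w /andP[_ /eqP e]]; last first.
  by rewrite (w1_cyc w v) // (w2_cyc w v).
rewrite sumr_const => /eqP; rewrite mulrn_eq0 subr_eq0 => /orP[|/eqP//].
move=> /eqP/card0_eq/(_ v).
by rewrite inE /= unfold_in /= cyclic_submod_id eqxx.
Qed.

Variables (chi : M -> K[i]) (sigma : R -> R).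
Hypothesis gen : generating_char chi sigma.

Lemma homogeneous_weightE (omega : M -> K[i]) v :
    homogeneous_weight omega ->
  omega v = 1 - unit_sum chi v / #|fin_units R|%:R.
Proof.
move=> hom; have U0 := card_fin_units_neq0 R K[i].
move: v; apply: homogeneous_weight_unique => //; split.
- rewrite /unit_sum (eq_bigr (fun=> 1)) => [|u _].
    by rewrite sumr_const divff // subrr.
  by rewrite rscale0r; case: gen => -[].
(* [Rv = Rw] gives [v] and [w] the same right annihilator. *)
- have [d hd] := unit_sum_rann gen.
  move=> v w vw; congr (1 - _ / _); rewrite !hd; apply: eq_bigr => r _.
  have rann x y : x \in cyclic_submod y -> y *:> r = 0 -> x *:> r = 0.
    by case/imsetP=> a _ -> y0; rewrite scaler_rscale y0 scaler0.
  congr (_ * (nat_of_bool _)%:R).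
  apply/eqP/eqP; apply: rann; first by rewrite vw cyclic_submod_id.
  by rewrite -vw cyclic_submod_id.
- move=> v v0; rewrite big_split /= sumr_const sumrN -mulr_suml.
  rewrite [X in X / _](_ : _ = 0) ?mul0r ?subr0 //.
  (* For each unit [u], the character [chi (w *:> u)] of [w] is nontrivial on [Rv], because
     [v *:> u] is nonzero. *)
  rewrite exchange_big /= big1 // => u Uu.
  have [r chi_rvu] : exists r, chi (r *: v *:> u) != 1.
    apply/existsP; apply: contraNT v0; rewrite negb_exists => /forallP vu1.
    have [u' [_ uu']] := fin_unitsP u Uu.
    suff vu0 : v *:> u = 0 by rewrite -[v]rscaler1 -uu' -rscalerA vu0 rscale0r.
    case: gen => _ + _ _ _; apply => r; rewrite -scaler_rscale.
    by apply/eqP/negPn/vu1.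
  apply: (sum_add_char_set (theta := fun w => chi (w *:> u))
    (a := r *: v)) => //.
  + move=> _ _ /imsetP[s _ ->] /imsetP[t _ ->].
    by rewrite -scalerDl; apply: imset_f.
  + exact: (generating_char_rscalel gen).
  + exact: imset_f.
Qed.

Lemma homogeneous_weight_rscale (omega : M -> K[i]) v u :
    homogeneous_weight omega -> u \in fin_units R ->
  omega (v *:> u) = omega v.
Proof.
by move=> hom Uu; rewrite !(homogeneous_weightE _ hom) unit_sum_rscale.
Qed.

Lemma weight_sumE (omega : M -> K[i]) n (v : {ffun 'I_n -> M}) :
    homogeneous_weight omega ->
  weight_sum omega v =
    n%:R - (\sum_i unit_sum chi (v i)) / #|fin_units R|%:R.
Proof.
move=> hom; rewrite /weight_sum mulr_suml -[n in n%:R]card_ord.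
rewrite -sumr_const -sumrB.
by apply: eq_bigr => i _; rewrite (homogeneous_weightE _ hom).
Qed.

Lemma weight_sum_eq (omega : M -> K[i]) n (v w : {ffun 'I_n -> M}) :
    homogeneous_weight omega ->
  weight_sum omega v = weight_sum omega w <->
    \sum_i unit_sum chi (v i) = \sum_i unit_sum chi (w i).
Proof.
move=> hom; rewrite !(weight_sumE _ hom); split=> [|-> //].
move=> /addrI/oppr_inj/mulIf; apply.
by rewrite invr_eq0 card_fin_units_neq0.
Qed.

(** [n - wtH (r *: v)] counts the coordinates of [v] killed by [r], which is what [unit_sum_lann]
    adds up. *)
Lemma sum_unit_sum_wtH n (v w : {ffun 'I_n -> M}) :
    (forall r, wtH (r *: v) = wtH (r *: w)) ->
  \sum_i unit_sum chi (v i) = \sum_i unit_sum chi (w i).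
Proof.
have [d hd] := unit_sum_lann gen; move=> vw.
have sumE (x : {ffun 'I_n -> M}) :
    \sum_i unit_sum chi (x i) = \sum_r d r * (n - wtH (r *: x))%:R.
  under eq_bigr do rewrite hd.
  rewrite exchange_big /=; apply: eq_bigr => r _; rewrite -mulr_sumr.
  rewrite -natr_sum.
  rewrite -(@big_mkcond _ _ addn _ _ (fun i => r *: x i == 0) (fun=> 1%N)).
  rewrite sum1dep_card cardsE /wtH cardsE; congr (_ * _%:R).
  have := cardC (fun i => (r *: x) i != 0); rewrite card_ord => cC.
  rewrite -[X in (X - _)%N]cC addKn.
  by apply: eq_card => i; rewrite !inE negbK ffunE.
by rewrite !sumE; apply: eq_bigr => r _; rewrite vw.
Qed.

End Homogeneous.

(** * Matching two families of coordinates up to units *)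

Section Matching.
Variables (F : numFieldType) (R : finNzRingType) (M : finBimodType R).
Variables (chi : M -> F) (sigma : R -> R).
Hypothesis gen : generating_char chi sigma.
Variables (X : finLmodType R) (n : nat) (p q : 'I_n -> X -> M).
Hypotheses (p_lin : forall i, linear (p i)) (q_lin : forall i, linear (q i)).
Hypothesis pq : forall x,
  \sum_i unit_sum chi (p i x) = \sum_i unit_sum chi (q i x).
Let U := fin_units R.

Let times (g : {ffun X -> M}) (u : R) := [ffun x => g x *:> u].
Let ff (h : 'I_n -> X -> M) i : {ffun X -> M} := [ffun x => h i x].
Let hits (h : 'I_n -> X -> M) (g : {ffun X -> M}) : {set 'I_n * R} :=
  [set a | (a.2 \in U) && (times (ff h a.1) a.2 == g)].
Let orbit (g : {ffun X -> M}) := [set times g u | u in U].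

Let times_lin h i u : linear (h i) -> linear (times (ff h i) u).
Proof.
move=> lin a x y; rewrite !ffunE lin rscalerDl.
by rewrite scaler_rscale.
Qed.

Let lin_char (g : X -> M) : linear g -> add_char (fun x => chi (g x)).
Proof.
move=> lin; have [c0 cD] : add_char chi by case: gen.
have gD x y : g (x + y) = g x + g y by have := lin 1 x y; rewrite !scale1r.
split=> [|x y]; last by rewrite gD.
suff -> : g 0 = 0 by [].
by apply: (addrI (g 0)); rewrite -gD !addr0.
Qed.

(** The values of [g - h] form a left submodule, and [chi] is trivial on the zero submodule only. *)
Let lin_inj (g h : X -> M) : linear g -> linear h ->
  [forall x, chi (g x) == chi (h x)] = [forall x, g x == h x].
Proof.
move=> ling linh; apply/forallP/forallP => e x; last by rewrite (eqP (e x)).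
rewrite -subr_eq0; apply/eqP; case: gen => chiC + _ _ _; apply => r.
have Z (k : X -> M) : linear k -> k (r *: x) = r *: k x.
  move=> lin; have k0 : k 0 = 0.
    have := lin 1 0 0; rewrite !scale1r !addr0 => e0.
    by apply: (addrI (k 0)); rewrite -e0 addr0.
  by have := lin r x 0; rewrite k0 !addr0.
by rewrite scalerBr add_char_subr // -!Z //; apply/eqP.
Qed.

(** [pq] equates two sums of characters indexed by pairs of a coordinate and a unit;
    [count_add_char] extracts the multiplicity of [chi (g x)]. *)
Let card_hits g : #|hits p g| = #|hits q g|.
Proof.
(* A map that is hit is a unit multiple of a coordinate, hence linear; otherwise both sets are
   empty. *)
have [glin|no] :=
  boolP ([exists a, a \in hits p g] || [exists a, a \in hits q g]).
  have {}glin : linear g.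
    case/orP: glin => /existsP[a]; rewrite inE => /andP[_ /eqP<-];
      exact: times_lin.
  pose th (h : 'I_n -> X -> M) (a : 'I_n * R) x := chi (h a.1 x *:> a.2).
  have hitsE h : (forall i, linear (h i)) -> hits h g =
      [set a | (a.2 \in U) && [forall x, th h a x == chi (g x)]].
    move=> lin; apply/setP => a; rewrite !inE; congr andb.
    have <- : [forall x, times (ff h a.1) a.2 x == g x] =
        (times (ff h a.1) a.2 == g).
      by apply/forallP/eqP => [e|-> //]; apply/ffunP => x; apply/eqP.
    rewrite -lin_inj //; last exact: times_lin.
    by apply: eq_forallb => x; rewrite !ffunE.
  have thC h : (forall i, linear (h i)) -> forall a, add_char (th h a).
    move=> lin a; have := lin_char (times_lin a.2 (lin a.1)).
    case=> t0 tD; split=> [|x y]; rewrite /th.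
      by move: t0; rewrite !ffunE.
    by move: (tD x y); rewrite !ffunE.
  rewrite !hitsE //; apply: count_add_char; try exact: thC.
    exact: lin_char.
  by move=> x; have := pq x; rewrite /unit_sum !pair_big_dep.
move: no; rewrite negb_or !negb_exists => /andP[/forallP h1 /forallP h2].
by rewrite !eq_card0 // => a; apply/negbTE.
Qed.

Let orbit_id g : g \in orbit g.
Proof.
apply/imsetP; exists 1; first exact: fin_units1.
by apply/ffunP => x; rewrite ffunE rscaler1.
Qed.

Let orbit_times g h u :
  u \in U -> (times g u \in orbit h) = (orbit g == orbit h).
Proof.
have timesM k a b : times (times k a) b = times k (a * b).
  by apply/ffunP => x; rewrite !ffunE rscalerA.
have orbitM k a : a \in U -> orbit (times k a) = orbit k.
  move=> Ua; have [b [ba ab]] := fin_unitsP a Ua.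
  apply/setP => l; apply/imsetP/imsetP => -[c Uc ->].
    by exists (a * c); [apply: fin_unitsM | rewrite timesM].
  exists (b * c); last by rewrite timesM mulrA ab mul1r.
  by apply: fin_unitsM => //; apply/fin_unitsP; exists a.
move=> Uu; rewrite -(orbitM g u Uu).
by apply/idP/eqP => [/imsetP[a Ua ->]|<-]; [apply: orbitM | apply: orbit_id].
Qed.

(** Summed over an orbit, the hits count each coordinate in that orbit once per unit, whatever its
    stabiliser; dividing by [#|U|] leaves the multiplicity. *)
Let count_orbit g :
  count_mem (orbit g) (codom (fun i => orbit (ff q i))) =
  count_mem (orbit g) (codom (fun i => orbit (ff p i))).
Proof.
have total h : \sum_(k in orbit g) #|hits h k| =
    (#|U| * count_mem (orbit g) (codom (fun i => orbit (ff h i))))%N.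
  rewrite (eq_bigr (fun k =>
      \sum_(a | a.2 \in U) (times (ff h a.1) a.2 == k)))%N; last first.
    move=> k _; rewrite -sum1_card big_mkcond [RHS]big_mkcond.
    by apply: eq_bigr => a _; rewrite inE; case: (a.2 \in U); case: eqP.
  rewrite exchange_big /=.
  rewrite (eq_bigr (fun a => (orbit (ff h a.1) == orbit g) : nat)); last first.
    move=> a Ua; rewrite -(orbit_times _ _ Ua) -big_mkcondr sum1dep_card.
    case: (boolP (_ \in orbit g)) => [og|nog].
      rewrite (@eq_card _ _ (pred1 (times (ff h a.1) a.2))) ?card1 // => k.
      by rewrite !inE eq_sym; case: eqP => [->|]; rewrite ?og ?andbF.
    rewrite eq_card0 // => k; rewrite !inE.
    apply/negbTE/negP => /andP[ok /eqP e].
    by rewrite e ok in nog.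
  rewrite -(pair_big_dep xpredT (fun _ u => u \in U)
    (fun i _ => (orbit (ff h i) == orbit g) : nat)) /=.
  under eq_bigr do rewrite sum_nat_const.
  rewrite -big_distrr /= -sum1_count big_map big_enum_cond /=.
  by congr muln; rewrite [RHS]big_mkcond.
have U0 : (0 < #|U|)%N by apply/card_gt0P; exists 1; apply: fin_units1.
apply/eqP; rewrite -(eqn_pmul2l U0) -!total; apply/eqP/eq_bigr => k _.
by rewrite card_hits.
Qed.

Lemma unit_sum_monomial :
  exists (s : {perm 'I_n}) (u : 'I_n -> R), (forall i, u i \in U) /\
    forall i x, q i x = p (s i) x *:> u i.
Proof.
(* Equal multiplicities make the two tuples of orbits rearrangements of each other; the
   rearrangement is [s]. *)
have : perm_eq [tuple orbit (ff q i) | i < n] [tuple orbit (ff p i) | i < n].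
  apply/allP => O; rewrite mem_cat => /orP[] /codomP[i ->] /=.
    by rewrite count_orbit.
  by rewrite count_orbit.
case/tuple_permP => s /val_inj e; exists s.
have ex i : exists u, (u \in U) && (ff q i == times (ff p (s i)) u).
  have : orbit (ff q i) = orbit (ff p (s i)).
    by have := congr1 (fun t => tnth t i) e; rewrite !tnth_mktuple.
  move=> E; have := orbit_id (ff q i); rewrite E => /imsetP[u Uu ->].
  by exists u; rewrite Uu eqxx.
have [u hu] := fin_all_exists ex; exists u.
split=> i; first by case/andP: (hu i).
by case/andP: (hu i) => _ /eqP/ffunP e' x; move: (e' x); rewrite !ffunE.
Qed.

End Matching.

(** * The monomial matrix of a matching *)

Section MonomialMatrix.
Variables (R : finNzRingType) (M : finBimodType R) (n : nat).
Variables (s : {perm 'I_n}) (u : 'I_n -> R).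
Hypothesis Uu : forall i, u i \in fin_units R.

Definition perm_units_mx : 'M[R]_n :=
  \matrix_(i, j) if i == s j then u j else 0.

Lemma vmulmx_perm_units (v : {ffun 'I_n -> M}) j :
  vmulmx v perm_units_mx j = v (s j) *:> u j.
Proof.
rewrite ffunE (bigD1 (s j)) //= mxE eqxx big1 ?addr0 // => i /negPf ij.
by rewrite mxE ij rscaler0.
Qed.

Lemma monomial_perm_units : monomial_mx perm_units_mx.
Proof.
have [w hw] : exists w, forall i, w i * u i = 1 /\ u i * w i = 1.
  have ex i := elimT (fin_unitsP (u i)) (Uu i).
  by have [w hw] := fin_all_exists ex; exists w.
have u0 i : u i != 0.
  apply/eqP => ui0; have := (hw i).1.
  by rewrite ui0 mulr0 => /esym/eqP; rewrite oner_eq0.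
split.
(* The inverse has the transposed support and the inverse units. *)
- exists (\matrix_(j, k) if k == s j then w j else 0).
  split; apply/matrixP => i k; rewrite !mxE.
    rewrite (bigD1 (s^-1 i)%g) //= big1 => [|j ij].
      rewrite !mxE permKV eqxx addr0 eq_sym.
      by case: (i == k); rewrite ?(hw _).2 ?mulr0.
    rewrite !mxE; case: eqP => [e|]; last by rewrite mul0r.
    by rewrite e permK eqxx in ij.
  rewrite (bigD1 (s i)) //= big1 => [|j ij].
    rewrite !mxE eqxx addr0 (inj_eq perm_inj).
    by case: eqP => [->|]; rewrite ?(hw _).1 ?mulr0.
  by rewrite !mxE (negPf ij) mul0r.
- move=> i; rewrite -(cards1 (s^-1 i)%g); congr #|pred_of_set _|.
  apply/setP => j; rewrite !inE mxE.
  rewrite -[RHS](inj_eq (@perm_inj _ s)) permKV [RHS]eq_sym.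
  by case: (i == s j); rewrite ?u0 ?eqxx.
- move=> j; rewrite -(cards1 (s j)); congr #|pred_of_set _|.
  by apply/setP => i; rewrite !inE mxE; case: (i == s j); rewrite ?u0 ?eqxx.
Qed.

Lemma wtH_vmulmx_perm_units (v : {ffun 'I_n -> M}) :
  wtH (vmulmx v perm_units_mx) = wtH v.
Proof.
rewrite /wtH -(card_preimset [set i | v i != 0] (@perm_inj _ s)).
apply: eq_card => j; rewrite !inE vmulmx_perm_units; congr (~~ _).
apply/eqP/eqP => [e|->]; last by rewrite rscale0r.
have [w [_ uw]] := fin_unitsP _ (Uu j).
by rewrite -[LHS]rscaler1 -uw -rscalerA e rscale0r.
Qed.

End MonomialMatrix.

Lemma vmulmx_linear (R : finNzRingType) (M : finBimodType R) n (A : 'M[R]_n) :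
  linear (fun v : {ffun 'I_n -> M} => vmulmx v A).
Proof.
move=> a v w; apply/ffunP => j; rewrite !ffunE scaler_sumr -big_split /=.
by apply: eq_bigr => i _; rewrite !ffunE rscalerDl scaler_rscale.
Qed.

(** The code must be a finite module in its own right, since orthogonality is applied on it. *)
HB.instance Definition _ (R : finNzRingType) (M : finBimodType R) n
  (C : submodClosed {ffun 'I_n -> M}) := [Countable of submod C by <:].
HB.instance Definition _ (R : finNzRingType) (M : finBimodType R) n
  (C : submodClosed {ffun 'I_n -> M}) := [Finite of submod C by <:].

Theorem theorem4p19 (K : realType) (R : finNzRingType) (M : finBimodType R)
    (hM : Frobenius_bimodule K M) (n : nat)
    (omega : M -> K[i]) (homega : homogeneous_weight omega)
    (C : submodClosed {ffun 'I_n -> M}) :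
  (forall f : {linear submod C -> {ffun 'I_n -> M}},
     preserves (weight_sum omega) f ->
     (exists2 A : 'M[R]_n, monomial_mx A &
        forall v : submod C, f v = vmulmx (\val v) A) /\
     (exists2 g : {linear {ffun 'I_n -> M} -> {ffun 'I_n -> M}},
        forall v, weight_sum omega (g v) = weight_sum omega v &
        forall v : submod C, g (\val v) = f v)) /\
  (forall f : {linear submod C -> {ffun 'I_n -> M}},
     preserves (weight_sum omega) f <-> preserves (@wtH R M n) f).
Proof.
have [chi [sigma gen]] := Frobenius_generating_char hM.
have monomial (f : {linear submod C -> {ffun 'I_n -> M}}) :
    preserves (weight_sum omega) f ->
  exists (s : {perm 'I_n}) (u : 'I_n -> R), (forall i, u i \in fin_units R) /\
    forall v : submod C, f v = vmulmx (\val v) (perm_units_mx s u).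
  move=> fP.
  have [||x|s [u [Uu E]]] := @unit_sum_monomial _ _ _ _ _ gen (submod C) n
      (fun i x => \val x i) (fun i x => f x i).
  - move=> i a x y.
    have -> : \val (a *: x + y) = a *: \val x + \val y by [].
    by rewrite !ffunE.
  - by move=> i a x y; rewrite !linearP !ffunE.
  - by apply/(weight_sum_eq gen _ _ homega)/esym/fP.
  exists s, u; split=> // v; apply/ffunP => j.
  by rewrite vmulmx_perm_units E.
split=> f.
  move=> /monomial[s [u [Uu fE]]]; split.
    by exists (perm_units_mx s u); first exact: monomial_perm_units.
  pose gL := GRing.isLinear.Build _ _ _ _ (fun v : {ffun 'I_n -> M} =>
    vmulmx v (perm_units_mx s u)) (@vmulmx_linear _ _ _ _).
  pose g : {linear {ffun 'I_n -> M} -> {ffun 'I_n -> M}} :=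
    HB.pack (fun v : {ffun 'I_n -> M} => vmulmx v (perm_units_mx s u)) gL.
  exists g => v /=; last by rewrite fE.
  (* The permutation reorders the summands, and units leave [omega] unchanged. *)
  rewrite /weight_sum [RHS](reindex_inj (@perm_inj _ s)) /=.
  apply: eq_bigr => i _; rewrite vmulmx_perm_units.
  exact: (homogeneous_weight_rscale gen).
split=> fP v.
  have [s [u [Uu ->]]] := monomial f fP.
  exact: wtH_vmulmx_perm_units.
(* Hamming weights of all multiples [r *: v] are required; linearity of [f] supplies them. *)
apply/(weight_sum_eq gen _ _ homega)/(sum_unit_sum_wtH gen) => r.
by rewrite -!linearZ -fP.
Qed.
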